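(* Let $G=(V,E)$ be a finite graph, let $d\in(0,\infty]$ and $K\in\mathbb{R}$. Then the following statements are equivalent. (i) $G$ satisfies the $CDE'(d,K)$ inequality. (ii) $G$ satisfies the $CD^{\log}_{\sqrt{\cdot}}(4d,K)$ inequality, i.e. the $CD^{\varphi}_{\psi}(4d,K)$ condition with $\varphi=\log$ and $\psi(x)=\sqrt{x}$.
   Context: A finite graph is a pair $G=(V,E)$ with $V$ a finite set and $E\subset V\times V$ a symmetric relation with $(v,v)\notin E$ for all $v$; write $v\sim w$ if $(v,w)\in E$. Let $\mathbb{R}^+=(0,\infty)$, $C(V)=\mathbb{R}^V$, and $C^+(V)=\{f:V\to\mathbb{R}^+\}$. Operations on functions on $V$ and inequalities between them are pointwise. Convention: $1/\infty=0$. Laplacian: $\Delta f(v)=\sum_{w\sim v}(f(w)-f(v))$ for $f\in C(V)$. Gradient forms: for $f,g\in C(V)$, $2\Gamma(f,g)=\Delta(fg)-f\Delta g-g\Delta f$ and $2\Gamma_2(f,g)=\Delta\Gamma(f,g)-\Gamma(f,\Delta g)-\Gamma(g,\Delta f)$; $\Gamma(f)=\Gamma(f,f)$, $\Gamma_2(f)=\Gamma_2(f,f)$. For $f\in C^+(V)$, $\widetilde{\Gamma}_2(f)=\Gamma_2(f)-\Gamma\left(f,\frac{\Gamma(f)}{f}\right)$. $CDE'(d,K)$: $G$ satisfies it if for all $f\in C^+(V)$, $\widetilde{\Gamma}_2(f)\ge\frac1d f^2(\Delta\log f)^2+K\Gamma(f)$. For $\psi\in C^1(\mathbb{R}^+)$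 and $f\in C^+(V)$, the $\psi$-Laplacian is $(\Delta^\psi f)(v)=\left(\Delta\left[\psi\left(\frac{f}{f(v)}\right)\right]\right)(v)$. For $\psi$ concave, put $\overline{\psi}(x)=\psi'(1)(x-1)-(\psi(x)-\psi(1))$ and $\Gamma^\psi=\Delta^{\overline\psi}$. Also $$(\Omega^\psi f)(v)=\left(\Delta\left[\psi'\left(\frac{f}{f(v)}\right)\cdot\frac{f}{f(v)}\left[\frac{\Delta f}{f}-\frac{(\Delta f)(v)}{f(v)}\right]\right]\right)(v),$$ $$2\Gamma_2^\psi(f)=\Omega^\psi f+\frac{\Delta f\,\Delta^\psi f}{f}-\frac{\Delta(f\Delta^\psi f)}{f}.$$ $CD^\varphi_\psi(d,K)$: for $d\in(0,\infty]$, $K\in\mathbb{R}$ and concave $\varphi,\psi\in C^1(\mathbb{R}^+)$, $G$ satisfies it if for all $f\in C^+(V)$, $\Gamma_2^\psi(f)\ge\frac1d(\Delta^\varphi f)^2+K\Gamma^\psi(f)$. *)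

(* Defs.v *)
From HB Require Import structures.
From mathcomp Require Import all_boot all_order all_algebra.
From mathcomp Require Import all_classical all_reals all_analysis.
From mathcomp Require Import ring.

Set Implicit Arguments.
Unset Strict Implicit.
Unset Printing Implicit Defensive.

Import Order.TTheory GRing.Theory Num.Theory.
Import numFieldNormedType.Exports.

Local Open Scope classical_set_scope.
Local Open Scope ring_scope.

(* A finite graph is given by a finType V and a symmetric irreflexive e : rel V;
   C(V) is the type V -> R. *)

Section Gradients.
Context {R : realType} {V : finType} (e : rel V).
Implicit Types f g : V -> R.

Definition pos_fun f : Prop := forall v, 0 < f v.

Definition laplacian f (v : V) : R := \sum_(w | e v w) (f w - f v).

Definition Gamma f g (v : V) : R :=
  (laplacian (fun w => f w * g w) v - f v * laplacian g v
    - g v * laplacian f v) / 2.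

Definition Gamma2 f g (v : V) : R :=
  (laplacian (Gamma f g) v - Gamma f (laplacian g) v
    - Gamma g (laplacian f) v) / 2.

Definition tGamma2 f (v : V) : R :=
  Gamma2 f f v - Gamma f (fun w => Gamma f f w / f w) v.

End Gradients.

(* The real number 1/d for d in ]0, +oo], with 1/+oo = 0. *)
Definition recip {R : realType} (d : \bar R) : R := fine (d^-1)%E.

Definition CDE' {R : realType} {V : finType} (e : rel V) (d : \bar R) (K : R) :
    Prop :=
  forall f : V -> R, pos_fun f -> forall v : V,
    recip d * (f v ^+ 2 * laplacian e (fun w => ln (f w)) v ^+ 2)
      + K * Gamma e f f v
    <= tGamma2 e f v.

(* Functions on ]0, +oo[ are represented by total functions R -> R.  Only their
   values and derivatives at positive reals are ever used below: psi is applied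
   to quotients f w / f v of positive numbers. *)
Section PsiGradients.
Context {R : realType} {V : finType} (e : rel V).
Implicit Types (psi : R -> R) (f : V -> R).

Definition psi_laplacian psi f (v : V) : R :=
  laplacian e (fun w => psi (f w / f v)) v.

Definition psi_bar psi (x : R) : R :=
  derive1 psi 1 * (x - 1) - (psi x - psi 1).

Definition psi_Gamma psi f (v : V) : R := psi_laplacian (psi_bar psi) f v.

Definition psi_Omega psi f (v : V) : R :=
  laplacian e (fun w =>
    derive1 psi (f w / f v) * (f w / f v)
      * (laplacian e f w / f w - laplacian e f v / f v)) v.

Definition psi_Gamma2 psi f (v : V) : R :=
  (psi_Omega psi f v + laplacian e f v * psi_laplacian psi f v / f v
    - laplacian e (fun w => f w * psi_laplacian psi f w) v / f v) / 2.

End PsiGradients.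

Record concaveC1 (R : realType) := ConcaveC1 {
  concaveC1_fun :> R -> R;
  concaveC1_derivable : forall x, 0 < x -> derivable concaveC1_fun x 1;
  concaveC1_continuous :
    forall x, 0 < x -> {for x, continuous (derive1 concaveC1_fun)};
  concaveC1_concave :
    convex_function (`]0, +oo[%classic : set R) (fun x => - concaveC1_fun x)
}.

Definition CDpsi {R : realType} {V : finType} (e : rel V)
    (phi psi : concaveC1 R) (d : \bar R) (K : R) : Prop :=
  forall f : V -> R, pos_fun f -> forall v : V,
    recip d * psi_laplacian e phi f v ^+ 2 + K * psi_Gamma e psi f v
    <= psi_Gamma2 e psi f v.

Section LogSqrt.
Context {R : realType}.

Let near_pos (x : R) : 0 < x -> \forall y \near x, 0 < y.
Proof. exact: lt_nbhsr. Qed.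

Lemma ln_derivable (x : R) : 0 < x -> derivable (@ln R) x 1.
Proof. by move=> x0; have [] := is_derive1_ln x0. Qed.

Lemma ln_derive_continuous (x : R) : 0 < x -> {for x, continuous (derive1 (@ln R))}.
Proof.
move=> x0; have dE y : 0 < y -> derive1 (@ln R) y = y^-1.
  by move=> y0; rewrite derive1E; apply: derive_val; exact: is_derive1_ln.
rewrite /prop_for /continuous_at dE//.
apply: (@cvg_trans _ ((fun y : R => y^-1) @ x)); last first.
  by apply: inv_continuous; rewrite gt_eqF.
apply: near_eq_cvg; near=> y; rewrite dE//.
by near: y; exact: near_pos.
Unshelve. all: by end_near. Qed.

Lemma ln_concave :
  convex_function (`]0, +oo[%classic : set R) (fun x => - @ln R x).
Proof.
move=> t x y; rewrite !inE/= !in_itv/= !andbT => x0 y0.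
have := concave_ln t x0 y0.
by rewrite !convRE !mulrN -opprD lerN2.
Qed.

Definition log_C1 : concaveC1 R :=
  ConcaveC1 ln_derivable ln_derive_continuous ln_concave.

Lemma sqrt_derivable (x : R) : 0 < x -> derivable (@Num.sqrt R) x 1.
Proof. by move=> x0; have [] := is_derive1_sqrt x0. Qed.

Lemma sqrt_derive_continuous (x : R) :
  0 < x -> {for x, continuous (derive1 (@Num.sqrt R))}.
Proof.
move=> x0; have dE y : 0 < y -> derive1 (@Num.sqrt R) y = (2 * Num.sqrt y)^-1.
  by move=> y0; rewrite derive1E derive_sqrt.
rewrite /prop_for /continuous_at dE//.
apply: (@cvg_trans _ ((fun y : R => (2 * Num.sqrt y)^-1) @ x)); last first.
  have nz : 2 * Num.sqrt x != 0 by rewrite mulf_neq0// gt_eqF// sqrtr_gt0.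
  have c2 : 2 * Num.sqrt y @[y --> x] --> 2 * Num.sqrt x.
    by apply: cvgMl_tmp; exact: sqrt_continuous.
  exact: (cvgV nz c2).
apply: near_eq_cvg; near=> y; rewrite dE//.
by near: y; exact: near_pos.
Unshelve. all: by end_near. Qed.

Lemma sqrt_concave :
  convex_function (`]0, +oo[%classic : set R) (fun x => - @Num.sqrt R x).
Proof.
move=> t x y; rewrite !inE/= !in_itv/= !andbT => x0 y0.
have [u0 u1] : 0 <= (t%:num : R) /\ 0 <= 1 - (t%:num : R).
  by rewrite subr_ge0.
set u : R := t%:num in u0 u1.
suff : u * Num.sqrt x + (1 - u) * Num.sqrt y
    <= Num.sqrt (u * (x : R) + (1 - u) * (y : R)).
  by rewrite -lerN2 opprD -!mulrN.
have [a0 b0] := (sqrtr_ge0 x, sqrtr_ge0 y).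
rewrite -[X in Num.sqrt (u * X + _)](sqr_sqrtr (ltW x0)).
rewrite -[X in Num.sqrt (_ + (1 - u) * X)](sqr_sqrtr (ltW y0)).
set a := Num.sqrt x in a0 *; set b := Num.sqrt y in b0 *.
have e0 : 0 <= u * a + (1 - u) * b by rewrite addr_ge0// mulr_ge0.
rewrite -[leLHS](ger0_norm e0) -sqrtr_sqr ler_wsqrtr// -subr_ge0.
have -> : u * a ^+ 2 + (1 - u) * b ^+ 2 - (u * a + (1 - u) * b) ^+ 2
  = u * (1 - u) * (a - b) ^+ 2 by ring.
by rewrite mulr_ge0 ?sqr_ge0 ?mulr_ge0.
Qed.

Definition sqrt_C1 : concaveC1 R :=
  ConcaveC1 sqrt_derivable sqrt_derive_continuous sqrt_concave.

End LogSqrt.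

(* Main.v *)
Require Import Defs.
From mathcomp Require Import all_boot all_order all_algebra.
From mathcomp Require Import all_classical all_reals all_analysis.
From mathcomp Require Import ring.

Import Order.TTheory GRing.Theory Num.Theory.

(** The two conditions are the same inequality, read off at functions that
    correspond to each other under the bijection [g |-> g ^+ 2] of the positive
    functions. For [f = g ^+ 2] with [g] positive,

    - the [log]-Laplacian of [f] is [2 Delta (ln g)];
    - the [sqrt]-Laplacian of [f] is [Delta g / g];
    - [psi_bar x = (sqrt x - 1)^2 / 2] for [psi = sqrt], hence
      [Gamma^psi f = Gamma g / g ^+ 2];
    - [Gamma_2^psi f = tGamma2 g / g ^+ 2], the key identity.

    Multiplying the condition for [f] by [g ^+ 2] gives the condition for [g],
    and the factor 4 that comes from squaring [2 Delta (ln g)] turns [1 / (4 d)]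
    into [1 / d].

    For the key identity, [Delta f = 2 g Delta g + 2 Gamma g], that is,
    [Delta g + Gamma g / g = Delta f / (2 g)]. Expanding every [Gamma] in
    [tGamma2 g] by its definition, the two [Delta (Gamma g)] cancel and
    the terms in [Gamma g / g] combine with those in [Delta g], so that
    [2 tGamma2 g = g Delta (Delta f / (2 g)) - Delta (g Delta g)
                   + Delta g Delta f / (2 g)].
    On the other side [x psi' x = sqrt x / 2] gives
    [g ^+ 2 Omega^psi f = g Delta (Delta f / (2 g)) - Delta g Delta f / (2 g)],
    and the other two terms of [2 g ^+ 2 Gamma_2^psi f] are
    [Delta g Delta f / g] and [- Delta (g Delta g)]. *)

Local Open Scope ring_scope.

Section Laplacian.
Context {R : realType} {V : finType} {e : rel V}.
Implicit Types f g h : V -> R.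

Lemma eq_laplacian {f g} : f =1 g -> laplacian e f =1 laplacian e g.
Proof. by move=> fg v; apply: eq_bigr => w _; rewrite !fg. Qed.

Lemma laplacian_linear (a b : R) f g v :
  laplacian e (fun w => a * f w + b * g w) v
  = a * laplacian e f v + b * laplacian e g v.
Proof.
rewrite /laplacian !mulr_sumr -big_split /=.
by apply: eq_bigr => w _; ring.
Qed.

Lemma Gamma_sum g v : Gamma e g g v = \sum_(w | e v w) (g w - g v) ^+ 2 / 2.
Proof.
rewrite /Gamma /laplacian mulr_sumr -!sumrB mulr_suml.
by apply: eq_bigr => w _; ring.
Qed.

Lemma laplacian_sqr g v :
  laplacian e (fun w => g w ^+ 2) v
  = 2 * g v * laplacian e g v + 2 * Gamma e g g v.
Proof.
rewrite /Gamma (eq_laplacian (g := fun w => g w * g w)); last first.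
  by move=> w; rewrite expr2.
by field.
Qed.

Lemma laplacian_sqr_div g v : pos_fun g ->
  laplacian e (fun w => g w ^+ 2) v / g v
  = 2 * laplacian e g v + 2 * (Gamma e g g v / g v).
Proof. by move=> g0; rewrite laplacian_sqr; field; rewrite gt_eqF. Qed.

(** This form contains no [Gamma], only Laplacians of [g] and [g ^+ 2], which
    makes it comparable with [psi_Gamma2]. The correction term
    [Gamma g (Gamma g / g)] of [tGamma2] is what makes this possible: it removes
    [Delta (Gamma g)] and completes [Delta g] to [Delta (g ^+ 2) / (2 g)]. *)
Lemma tGamma2E g v : pos_fun g ->
  tGamma2 e g v
  = (g v * laplacian e (fun w => laplacian e (fun u => g u ^+ 2) w / g w) v / 2
     - laplacian e (fun w => g w * laplacian e g w) v
     + laplacian e g v * laplacian e (fun w => g w ^+ 2) v / (2 * g v)) / 2.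
Proof.
move=> g0.
have gn0 w : g w != 0 by rewrite gt_eqF.
(* T = Delta (g ^+ 2) / (2 g) - Delta g *)
pose T w := Gamma e g g w / g w.
rewrite (eq_laplacian
  (g := fun w => 2 * laplacian e g w + 2 * T w)); last first.
  by move=> w; rewrite laplacian_sqr_div.
rewrite laplacian_linear laplacian_sqr /tGamma2 /Gamma2.
rewrite [Gamma e g (fun _ => _ / _) v]/Gamma.
rewrite [Gamma e g (laplacian e g) v]/Gamma.
rewrite -/(T v) -[laplacian e (fun w => _ / _) v]/(laplacian e T v).
(* the second Delta (Gamma g), about to cancel *)
rewrite (eq_laplacian (f := fun w => g w * (_ / g w))
  (g := Gamma e g g)); last first.
  by move=> w; rewrite mulrC divfK.
by rewrite /T; field.
Qed.

End Laplacian.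

Section SquareRoot.
Context {R : realType} {V : finType} {e : rel V}.
Implicit Types g : V -> R.

Lemma sqrt_sqr_quotient g (w v : V) : pos_fun g ->
  Num.sqrt (g w ^+ 2 / g v ^+ 2) = g w / g v.
Proof.
by move=> g0; rewrite -expr_div_n sqrtr_sqr ger0_norm// ltW// divr_gt0.
Qed.

Lemma sqr_quotient_gt0 g (w v : V) : pos_fun g -> 0 < g w ^+ 2 / g v ^+ 2.
Proof. by move=> g0; rewrite divr_gt0// exprn_gt0. Qed.

Lemma log_laplacian_sqr g v : pos_fun g ->
  psi_laplacian e log_C1 (fun w => g w ^+ 2) v
  = 2 * laplacian e (fun w => ln (g w)) v.
Proof.
move=> g0; rewrite /psi_laplacian /laplacian mulr_sumr.
apply: eq_bigr => w _ /=.
have g20 u : g u ^+ 2 \is Num.pos by rewrite posrE exprn_gt0.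
by rewrite !ln_div// !lnXn//; ring.
Qed.

Lemma sqrt_laplacian_sqr g v : pos_fun g ->
  psi_laplacian e sqrt_C1 (fun w => g w ^+ 2) v = laplacian e g v / g v.
Proof.
move=> g0; rewrite /psi_laplacian /laplacian mulr_suml.
by apply: eq_bigr => w _ /=; rewrite !sqrt_sqr_quotient// mulrBl.
Qed.

Lemma sqrt_Gamma_sqr g v : pos_fun g ->
  psi_Gamma e sqrt_C1 (fun w => g w ^+ 2) v = Gamma e g g v / g v ^+ 2.
Proof.
move=> g0; rewrite /psi_Gamma /psi_laplacian Gamma_sum /laplacian mulr_suml.
have gn0 : g v != 0 by rewrite gt_eqF.
apply: eq_bigr => w _; rewrite /psi_bar /= derive1E derive_sqrt// sqrtr1.
by rewrite !sqrt_sqr_quotient//; field.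
Qed.

(** Since [x psi' x = sqrt x / 2] for [psi = sqrt], the function under the outer
    Laplacian is a combination, with coefficients frozen at [v], of
    [Delta (g ^+ 2) / g] and [g]. *)
Lemma sqrt_Omega_sqr g v : pos_fun g ->
  psi_Omega e sqrt_C1 (fun w => g w ^+ 2) v
  = (laplacian e (fun w => laplacian e (fun u => g u ^+ 2) w / g w) v
     - laplacian e (fun w => g w ^+ 2) v / g v ^+ 2 * laplacian e g v)
    / (2 * g v).
Proof.
move=> g0; rewrite /psi_Omega.
have gn0 w : g w != 0 by rewrite gt_eqF.
set L := laplacian e (fun w => g w ^+ 2).
rewrite (eq_laplacian (g := fun w =>
  (2 * g v)^-1 * (L w / g w) + - (L v / g v ^+ 2 / (2 * g v)) * g w)).
  by rewrite laplacian_linear; field.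
move=> w /=.
rewrite derive1E derive_sqrt ?sqr_quotient_gt0// sqrt_sqr_quotient//.
by field; rewrite !gn0.
Qed.

Lemma sqrt_Gamma2_sqr g v : pos_fun g ->
  psi_Gamma2 e sqrt_C1 (fun w => g w ^+ 2) v = tGamma2 e g v / g v ^+ 2.
Proof.
move=> g0; have gn0 w : g w != 0 by rewrite gt_eqF.
rewrite /psi_Gamma2 sqrt_Omega_sqr// sqrt_laplacian_sqr// tGamma2E//.
rewrite (eq_laplacian (f := fun w => _ * psi_laplacian _ _ _ _)
  (g := fun w => g w * laplacian e g w)).
  by field.
by move=> w; rewrite sqrt_laplacian_sqr//; field.
Qed.

End SquareRoot.

Lemma recip_mul4 {R : realType} (d : \bar R) : (0 < d)%E ->
  recip (4%:E * d)%E = recip d / 4.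
Proof.
rewrite /recip; case: d => [r|_|//].
  rewrite lte_fin => r0.
  rewrite -EFinM !inver !gt_eqF ?mulr_gt0//=.
  by rewrite invfM mulrC.
by rewrite gt0_muley ?lte_fin// invey /= mul0r.
Qed.

(** The two conditions agree function by function and vertex by vertex; the
    quantifiers over functions are matched only in the theorem, where every
    positive [f] is the square of [sqrt f]. *)
Lemma CD_log_sqrt_sqr {R : realType} {V : finType} {e : rel V} {d : \bar R}
    {K : R} {g : V -> R} {v : V} : (0 < d)%E -> pos_fun g ->
  (recip (4%:E * d)%E * psi_laplacian e log_C1 (fun w => g w ^+ 2) v ^+ 2
     + K * psi_Gamma e sqrt_C1 (fun w => g w ^+ 2) v
   <= psi_Gamma2 e sqrt_C1 (fun w => g w ^+ 2) v)
  = (recip d * (g v ^+ 2 * laplacian e (fun w => ln (g w)) v ^+ 2)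
       + K * Gamma e g g v
     <= tGamma2 e g v).
Proof.
move=> d0 g0.
rewrite recip_mul4// log_laplacian_sqr// sqrt_Gamma_sqr// sqrt_Gamma2_sqr//.
rewrite ler_pdivlMr ?exprn_gt0//; congr (_ <= _).
by field; rewrite gt_eqF.
Qed.

Theorem proposition2p3 (R : realType) (V : finType) (e : rel V)
    (esym : symmetric e) (eirr : irreflexive e)
    (d : \bar R) (d_gt0 : (0 < d)%E) (K : R) :
  CDE' e d K <-> CDpsi e log_C1 sqrt_C1 (4%:E * d)%E K.
Proof.
split=> [cde f f0 v | cd g g0 v].
  have g0 : pos_fun (fun w => Num.sqrt (f w)) by move=> w; rewrite sqrtr_gt0.
  have {1 2 3}-> : f = fun w => Num.sqrt (f w) ^+ 2.
    by apply/funext => w; rewrite sqr_sqrtr// ltW.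
  by rewrite CD_log_sqrt_sqr//; exact: cde.
rewrite -CD_log_sqrt_sqr//; apply: cd => w.
by rewrite exprn_gt0.
Qed.
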